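(* Let $\big((x_t^* )_{t=0}^{T},(u_t^* )_{t=0}^{T-1}\big)$ be an optimal state-action trajectory for the optimal control problem $$\min \sum_{t=0}^{T-1} c_t(x_t,u_t)\quad\text{subject to}\quad \begin{cases} x_{t+1}=A_tx_t+B_tu_t, & t=0,\dots,T-1,\\ x_0=x_{\mathrm{ini}},\quad x_T=x_{\mathrm{fin}}, &\\ u_t\in U_t, & t=0,\dots,T-1,\\ \mathscr F(u_0,\dots,u_{T-1})=\sum_{t=0}^{T-1}F_tu_t=0, &\end{cases}$$ (no constraints on $x_1,\dots,x_{T-1}$), where the data are as described in the context, $c_t(\xi,\cdot):U_t\to\mathbb R$ is convex for every $\xi\in\mathbb R^d$ and $t=0,\dots,T-1$, and $U_t$ is convex, compact and non-empty for each $t=0,\dots,T-1$. For $\theta\in\mathbb R$, $\gamma\in(\mathbb R^{\ell})^\star$, $\zeta\in(\mathbb R^{d})^\star$, $s\in\{0,\dots,T-1\}$, $\xi\in\mathbb R^d$, $\mu\in\mathbb R^m$ define $$H^{\theta,\gamma}(\zeta,s,\xi,\mu)=\langle \zeta,A_s\xi+B_s\mu\rangle-\theta\,c_s(\xi,\mu)-\langle\gamma,F_s\mu\rangle\in\mathbb R .$$ Then there exist a trajectory $(\eta^f_t)_{t=0}^{T-1}\subset(\mathbb R^d)^\star$ and a pair $(\eta^C,\eta^u)\in\mathbb R\times(\mathbb R^\ell)^\star$ such that: (i) $\eta^C\ge 0$; (ii) $(\eta^f_t)_{t=0}^{T-1}$ and $(\eta^C,\eta^u)$ do not simultaneously vanish;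 (iii) the state dynamics $x^*_{t+1}=A_tx^*_t+B_tu^*_t$ hold for $t=0,\dots,T-1$ and the adjoint dynamics are $$\eta^f_{t-1}=A_t^\top\eta^f_t-\eta^C\,\tfrac{\partial}{\partial\xi}c_t(x^*_t,u^*_t)\quad\text{for } t=1,\dots,T-1;$$ (iv) the transversality conditions are trivially satisfied: the conditions $\tfrac{\partial}{\partial\xi}H^{\eta^C,\eta^u}(\eta^f_0,0,x_0^*,u_0^* )-\eta^x_0=0$ and $\eta^f_{T-1}=-\eta^x_T$ hold for some $\eta^x_0,\eta^x_T\in(\mathbb R^d)^\star$, where $\eta^x_0,\eta^x_T$ are otherwise unrestricted (the dual cones of the tents of the singletons $\{x_{\mathrm{ini}}\}$, $\{x_{\mathrm{fin}}\}$ being all of $(\mathbb R^d)^\star$); (v) $H^{\eta^C,\eta^u}(\eta^f_t,t,x^*_t,u^*_t)=\max_{\mu\in U_t}H^{\eta^C,\eta^u}(\eta^f_t,t,x^*_t,\mu)$ for $t=0,\dots,T-1$; (vi) $\mathscr F(u^*_0,\dots,u^*_{T-1})=0$.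
   Context: Data: $T,d,m$ are positive integers; $A_t\in\mathbb R^{d\times d}$, $B_t\in\mathbb R^{d\times m}$ for $t=0,\dots,T-1$; $x_{\mathrm{ini}},x_{\mathrm{fin}}\in\mathbb R^d$; $c_t:\mathbb R^d\times\mathbb R^m\to\mathbb R$ is continuously differentiable for $t=0,\dots,T-1$; $U_t\subset\mathbb R^m$. An optimal state-action trajectory is a feasible pair of state and control sequences attaining the minimum. $V^\star$ is the dual space of $V$; $(\mathbb R^n)^\star$ is identified with $\mathbb R^n$ via the standard inner product $\langle\cdot,\cdot\rangle$, and partial derivatives are regarded as gradients. The dual cone of a convex cone $K\subset\mathbb R^n$ with vertex $v$ is $\{y\in(\mathbb R^n)^\star:\langle y,z-v\rangle\le0\ \text{for all } z\in K\}$. Frequency constraint map: for $u=(u_0,\dots,u_{T-1})\in(\mathbb R^m)^T$ let $u^{(k)}\in\mathbb R^T$ ($k=1,\dots,m$) be the sequence of $k$-th components. Let $\Phi\in\mathbb C^{T\times T}$ be the DFT matrix with entries $\Phi_{\xi t}=T^{-1/2}e^{-2\pi i\xi t/T}$, $\xi,t=0,\dots,T-1$, and $\bar\Phi=\mathrm{blkdiag}(\Phi,\dots,\Phi)\in\mathbb C^{mT\times mT}$. For each $k$ a set $W^{(k)}\subset\{0,\dots,T-1\}$ of allowed frequencies is given; $D^{(k)}$ is the matrix formed by the rows $e_\xi$ of the identity $I_T$ with $\xi\notin W^{(k)}$, and $D=\mathrm{blkdiag}(D^{(1)},\dots,D^{(m)})$. Let $L\in\mathbb R^{mT\times mT}$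 be the permutation matrix mapping the stacked vector $(u^{(1)},\dots,u^{(m)})$ to $(u_0,\dots,u_{T-1})$. Form $\begin{pmatrix}D\,\mathrm{Re}\,\bar\Phi\\ D\,\mathrm{Im}\,\bar\Phi\end{pmatrix}L^{-1}$, eliminate its zero rows if necessary, let $\ell$ be the resulting number of rows, and partition its columns as $[F_0\ F_1\ \cdots\ F_{T-1}]$ with $F_t\in\mathbb R^{\ell\times m}$. Then $\mathscr F(u_0,\dots,u_{T-1})=\sum_{t=0}^{T-1}F_tu_t$; the constraint $\mathscr F=0$ says that the DFT of $u^{(k)}$ is supported in $W^{(k)}$ for every $k$. *)

(* Defs.v *)
From HB Require Import structures.
From mathcomp Require Import all_boot all_order all_algebra.
From mathcomp Require Import all_classical all_reals all_analysis.
From mathcomp Require Import complex.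

Set Implicit Arguments.
Unset Strict Implicit.
Unset Printing Implicit Defensive.

Import Order.TTheory GRing.Theory Num.Theory.
Import numFieldNormedType.Exports.

Local Open Scope classical_set_scope.
Local Open Scope ring_scope.

(* R^n is 'cV[R]_n, and (R^n)^* is identified
   with it through [dot]. *)

Definition dot (R : realType) n (y z : 'cV[R]_n) : R := (y^T *m z) 0 0.

Definition grad (R : realType) n (f : 'cV[R]_n -> R) (x : 'cV[R]_n) :
    'cV[R]_n :=
  \col_i 'D_(delta_mx i 0) (f : 'cV[R]_n -> R^o) x.

(* Used on finite-dimensional V, where continuity of the differential in
   operator norm amounts to continuity of every directional derivative. *)
Definition continuously_differentiable (R : realType) (V : normedModType R)
    (f : V -> R) : Prop :=
  (forall z, differentiable (f : V -> R^o) z) /\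
  (forall v, continuous ('D_v (f : V -> R^o))).

Definition is_maximum (R : realType) (E : set R) (r : R) : Prop :=
  E r /\ ubound E r.

(* K is meant to be a convex cone with vertex v. *)
Definition dual_cone (R : realType) n (v : 'cV[R]_n) (K : set 'cV[R]_n) :
    set 'cV[R]_n :=
  [set y | forall z, K z -> dot y (z - v) <= 0].

Section FrequencyConstraint.
Variables (R : realType) (T m : nat).

Definition dft_mx : 'M[R[i]]_T :=
  \matrix_(xi, t)
    let a := 2 * pi * xi%:R * t%:R / T%:R in
    Complex ((Num.sqrt T%:R)^-1) 0 * Complex (cos a) (- sin a).

(* (u^(1), ..., u^(m)) has m blocks of length T, hence \sum_(k < m) T entries,
   and (u_0, ..., u_(T-1)) has T blocks of length m, hence \sum_(t < T) m. *)
Definition dft_bar : 'M[R[i]]_(\sum_(k < m) T) := \mxdiag_(k < m) dft_mx.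

Definition select_rows n p (S : {set 'I_n}) (M : 'M[R]_(n, p)) :
    'M[R]_(#|S|, p) :=
  rowsub (fun i : 'I_#|S| => enum_val i) M.

(* The (t, k) block puts the t-th entry of u^(k) at position k of u_t. *)
Definition L_mx : 'M[R]_(\sum_(t < T) m, \sum_(k < m) T) :=
  \mxblock_(t < T, k < m) delta_mx k t.

Lemma L_mx_stack (u : 'I_T -> 'cV[R]_m) :
  L_mx *m (\mxcol_(k < m) \col_(t < T) u t k 0) = \mxcol_(t < T) u t.
Proof.
rewrite mul_mxblock_mxrow; apply: eq_mxcol => t.
apply/colP => k; rewrite summxE (bigD1 k)//= big1 ?addr0 => [|k' k'k]; last first.
  rewrite mxE big1// => j _; rewrite !mxE.
  by rewrite eq_sym (negbTE k'k) mul0r.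
rewrite mxE (bigD1 t)//= big1 ?addr0 => [|j jt]; rewrite !mxE.
  by rewrite !eqxx mul1r.
by rewrite (negbTE jt) andbF mul0r.
Qed.

(* The row and column dimensions of L_mx are equal but not convertible, so
   invmx does not apply; L_mx being a permutation matrix, its inverse is its
   transpose (L_mxV, L_mxVK). *)
Definition L_inv : 'M[R]_(\sum_(k < m) T, \sum_(t < T) m) := L_mx^T.

Lemma L_mxV : L_mx *m L_inv = 1%:M.
Proof.
rewrite /L_inv /L_mx tr_mxblock mul_mxblock -mxdiagZ; apply: eq_mxblock => t t'.
under eq_bigr do rewrite trmx_delta.
case: eqVneq => [->|tt'].
  rewrite conform_mx_id; under eq_bigr do rewrite mul_delta_mx.
  by rewrite scalar_mx_sum_delta; under [RHS]eq_bigr do rewrite scale1r.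
by rewrite big1// => k _; rewrite mul_delta_mx_0.
Qed.

Lemma L_mxVK : L_inv *m L_mx = 1%:M.
Proof.
rewrite /L_inv /L_mx tr_mxblock mul_mxblock -mxdiagZ; apply: eq_mxblock => k k'.
under eq_bigr do rewrite trmx_delta.
case: eqVneq => [->|kk'].
  rewrite conform_mx_id; under eq_bigr do rewrite mul_delta_mx.
  by rewrite scalar_mx_sum_delta; under [RHS]eq_bigr do rewrite scale1r.
by rewrite big1// => t _; rewrite mul_delta_mx_0.
Qed.

Variable W : 'I_m -> {set 'I_T}.

Definition D_block (k : 'I_m) : 'M[R]_(#|~: W k|, T) :=
  select_rows (~: W k) 1%:M.

(* \mxdiag is restricted to square blocks. *)
Definition D_mx : 'M[R]_(\sum_(k < m) #|~: W k|, \sum_(k < m) T) :=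
  \mxblock_(k < m, k' < m) (D_block k *+ (k == k')).

Definition freq_full :
    'M[R]_(\sum_(k < m) #|~: W k| + \sum_(k < m) #|~: W k|, \sum_(t < T) m) :=
  col_mx (D_mx *m map_mx (@complex.Re R) dft_bar)
         (D_mx *m map_mx (@complex.Im R) dft_bar) *m L_inv.

Definition nonzero_rows : {set _} := finset (fun i => row i freq_full != 0).

Definition freq_dim : nat := #|nonzero_rows|.

Definition freq_mx : 'M[R]_(freq_dim, \sum_(t < T) m) :=
  select_rows nonzero_rows freq_full.

Definition freq_block (t : 'I_T) : 'M[R]_(freq_dim, m) := submxrow freq_mx t.

Definition freq_map (u : 'I_T -> 'cV[R]_m) : 'cV[R]_freq_dim :=
  \sum_(t < T) freq_block t *m u t.

Lemma select_rows_mul_eq0 n p (S : {set 'I_n}) (M : 'M[R]_(n, p))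
    (v : 'cV[R]_p) :
  select_rows S M *m v = 0 <-> forall i, i \in S -> (M *m v) i 0 = 0.
Proof.
have E j : (select_rows S M *m v) j 0 = (M *m v) (enum_val j) 0.
  by rewrite !mxE; apply: eq_bigr => k _; rewrite !mxE.
split=> [SM0 i iS|M0].
  by rewrite -(enum_rankK_in iS iS) -E SM0 mxE.
by apply/colP => j; rewrite E M0 ?enum_valP// mxE.
Qed.

Lemma freq_fullE (u : 'I_T -> 'cV[R]_m) :
  freq_full *m \mxcol_(t < T) u t =
  col_mx
    (\mxcol_(k < m) (D_block k *m
       (map_mx (@complex.Re R) dft_mx *m \col_(t < T) u t k 0)))
    (\mxcol_(k < m) (D_block k *m
       (map_mx (@complex.Im R) dft_mx *m \col_(t < T) u t k 0))).
Proof.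
have mapE (f : R[i] -> R) : f 0 = 0 ->
    map_mx f dft_bar = \mxdiag_(k < m) map_mx f dft_mx.
  move=> f0; apply/matrixP => i j; rewrite !mxE.
  by case: eqVneq => _; rewrite ?conform_mx_id !mxE.
have DE (M : 'M[R]_T) v_ : D_mx *m \mxdiag_(k < m) M *m (\mxcol_(k < m) v_ k) =
    \mxcol_(k < m) (D_block k *m (M *m v_ k)) :> 'cV[R]_(\sum_(k < m) #|~: W k|).
  rewrite -mulmxA mul_mxdiag_mxcol mul_mxblock_mxrow; apply: eq_mxcol => k.
  rewrite (bigD1 k)//= eqxx mulr1n big1 ?addr0// => k' k'k.
  by rewrite eq_sym (negbTE k'k) mulr0n mul0mx.
rewrite /freq_full -(L_mx_stack u) mulmxA -[_ *m L_inv *m L_mx]mulmxA L_mxVK.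
by rewrite mulmx1 mul_col_mx !mapE// !DE.
Qed.

Lemma freq_map_eq0 (u : 'I_T -> 'cV[R]_m) :
  freq_map u = 0 <->
  forall k xi, xi \notin W k ->
    \sum_(t < T) dft_mx xi t * Complex (u t k 0) 0 = 0.
Proof.
have -> : freq_map u = freq_mx *m \mxcol_(t < T) u t.
  by rewrite -[in RHS](submxrowK freq_mx) mul_mxrow_mxcol.
have sumE k xi : \sum_(t < T) dft_mx xi t * Complex (u t k 0) 0 =
    Complex ((map_mx (@complex.Re R) dft_mx *m \col_(t < T) u t k 0) xi 0)
            ((map_mx (@complex.Im R) dft_mx *m \col_(t < T) u t k 0) xi 0).
  rewrite !mxE; elim/big_ind3 : _ => // [_ a b _ a' b' -> ->//|t _].
  rewrite ![map_mx _ _ _ _]mxE ![(\col_j u j k 0) _ _]mxE; case: (dft_mx xi t) => a b /=.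
  rewrite -[LHS]/(Complex (a * u t k 0 - b * 0) (a * 0 + b * u t k 0)).
  by rewrite !mulr0 subr0 add0r.
rewrite select_rows_mul_eq0; transitivity (freq_full *m \mxcol_(t < T) u t = 0).
  split=> [F0|-> i _]; last by rewrite mxE.
  apply/colP => i; rewrite [RHS]mxE.
  have [|/negbNE/eqP iF] := boolP (row i freq_full != 0).
    by move=> iF; apply: F0; rewrite inE.
  by rewrite mxE big1// => j _; move/rowP: iF => /(_ j);
    rewrite !mxE => ->; rewrite mul0r.
rewrite freq_fullE; split=> [/eqP|H].
  rewrite col_mx_eq0 => /andP[/eqP/mxcolP Re0 /eqP/mxcolP Im0] k xi xiW.
  move: (Re0 k) (Im0 k); rewrite !mxcolK !submxcol0.
  move=> /select_rows_mul_eq0/(_ xi) + /select_rows_mul_eq0/(_ xi).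
  by rewrite inE !mul1mx sumE => -> // ->.
apply/eqP; rewrite col_mx_eq0; apply/andP; split; apply/eqP/mxcolP => k;
  rewrite mxcolK submxcol0; apply/select_rows_mul_eq0 => xi;
  by rewrite inE mul1mx => /(H k); rewrite sumE => -[].
Qed.

End FrequencyConstraint.

Definition ord_first T (T_gt0 : (0 < T)%N) : 'I_T := Ordinal T_gt0.

Definition ord_last T (T_gt0 : (0 < T)%N) : 'I_T := rev_ord (Ordinal T_gt0).

Lemma val_ord_last T (T_gt0 : (0 < T)%N) : ord_last T_gt0 = T.-1 :> nat.
Proof. exact: subn1. Qed.

(* State trajectories are indexed by 'I_T.+1: for t : 'I_T, x_t is
   x (widen_ord (leqnSn T) t) and x_{t+1} is x (lift ord0 t). *)
Section OptimalControl.
Variables (R : realType) (T d m : nat).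
Variables (A : 'I_T -> 'M[R]_d) (B : 'I_T -> 'M[R]_(d, m)).
Variables (c : 'I_T -> 'cV[R]_d * 'cV[R]_m -> R).
Variable W : 'I_m -> {set 'I_T}.

Definition state_dynamics (x : 'I_T.+1 -> 'cV[R]_d) (u : 'I_T -> 'cV[R]_m) :
    Prop :=
  forall t : 'I_T,
    x (lift ord0 t) = A t *m x (widen_ord (leqnSn T) t) + B t *m u t.

Definition cost (x : 'I_T.+1 -> 'cV[R]_d) (u : 'I_T -> 'cV[R]_m) : R :=
  \sum_(t < T) c t (x (widen_ord (leqnSn T) t), u t).

Definition feasible (xini xfin : 'cV[R]_d) (U : 'I_T -> set 'cV[R]_m)
    (x : 'I_T.+1 -> 'cV[R]_d) (u : 'I_T -> 'cV[R]_m) : Prop :=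
  [/\ state_dynamics x u,
      x ord0 = xini /\ x ord_max = xfin,
      forall t, U t (u t) &
      freq_map W u = 0].

Definition optimal (xini xfin : 'cV[R]_d) (U : 'I_T -> set 'cV[R]_m)
    (x : 'I_T.+1 -> 'cV[R]_d) (u : 'I_T -> 'cV[R]_m) : Prop :=
  feasible xini xfin U x u /\
  forall x' u', feasible xini xfin U x' u' -> cost x u <= cost x' u'.

Definition hamiltonian (theta : R) (gamma : 'cV[R]_(freq_dim R W))
    (zeta : 'cV[R]_d) (s : 'I_T) (xi : 'cV[R]_d) (mu : 'cV[R]_m) : R :=
  dot zeta (A s *m xi + B s *m mu) - theta * c s (xi, mu)
  - dot gamma (freq_block R W s *m mu).

End OptimalControl.

(* Main.v *)
Require Import Defs.
From HB Require Import structures.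
From mathcomp Require Import all_boot all_order all_algebra.
From mathcomp Require Import all_classical all_reals all_analysis.
From mathcomp Require Import lra ring.

Set Implicit Arguments.
Unset Strict Implicit.
Unset Printing Implicit Defensive.

Import Order.TTheory GRing.Theory Num.Theory.
Import numFieldNormedType.Exports.

Local Open Scope classical_set_scope.
Local Open Scope ring_scope.

(** The dynamics and the frequency constraint are affine and the control sets
    are convex, so the segment between two feasible trajectories is feasible.
    Optimality then says that the differential of the cost is nonnegative on
    every variation of the trajectory that keeps the end point and the
    frequency constraint ([optimal_dcost_ge0]). Drop these two requirements and
    record, for each variation, the differential of the cost increased by a
    positive slack, the displacement of the final state and the
    value of the frequency map. The triples form a convex cone in
    R^(1 + d + l) that misses the origin ([variation_cone_blunt]), and a
    functional that is nonnegative on that cone consists of the multipliers of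
    the cost, of the end point and of the frequency constraint
    ([multipliers_exist]).

    The cone may have empty interior and its closure contains the origin, so
    strict separation is impossible. In finite dimension a convex cone
    without its vertex still has a nonzero nonnegative functional
    ([blunt_cone_separation]): a maximal such cone is the positive part of a
    linear order of R^n, and a functional is read off from Dedekind cuts along
    an order unit.

    The costate solves the adjoint recursion backwards from the multiplier of
    the end point. Pairing it with a variation of the state
    ([costate_pairing]) removes the state from the separating inequality, which
    falls apart into one inequality per time because the controls at different
    times can be varied independently ([linearized_maximum_principle]). Each of
    them is the first-order condition for the maximum of the Hamiltonian, and it
    is sufficient because the cost is convex in the control
    ([convex_gradient_ineq]). *)

(** * Separation of a convex cone from its missing vertex *)

Section Dot.
Variables (R : realType) (n : nat).
Implicit Types y z : 'cV[R]_n.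

Lemma dotE y z : dot y z = \sum_i y i 0 * z i 0.
Proof. by rewrite /dot mxE; apply: eq_bigr => i _; rewrite mxE. Qed.

Lemma dotDr y z1 z2 : dot y (z1 + z2) = dot y z1 + dot y z2.
Proof. by rewrite /dot mulmxDr mxE. Qed.

Lemma dotNr y z : dot y (- z) = - dot y z.
Proof. by rewrite /dot mulmxN mxE. Qed.

Lemma dotBr y z1 z2 : dot y (z1 - z2) = dot y z1 - dot y z2.
Proof. by rewrite dotDr dotNr. Qed.

Lemma dotBl y1 y2 z : dot (y1 - y2) z = dot y1 z - dot y2 z.
Proof. by rewrite /dot linearB mulmxBl !mxE. Qed.

Lemma dotNl y z : dot (- y) z = - dot y z.
Proof. by rewrite /dot linearN mulNmx mxE. Qed.

Lemma dotZl a y z : dot (a *: y) z = a * dot y z.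
Proof. by rewrite /dot linearZ -scalemxAl mxE. Qed.

Lemma dotr0 y : dot y 0 = 0.
Proof. by rewrite /dot mulmx0 mxE. Qed.

Lemma dot_sumr (I : Type) (s : seq I) y (z : I -> 'cV[R]_n) :
  dot y (\sum_(i <- s) z i) = \sum_(i <- s) dot y (z i).
Proof. by rewrite /dot mulmx_sumr summxE. Qed.

End Dot.

Lemma dot_tr (R : realType) n p (M : 'M[R]_(n, p)) y z :
  dot (M^T *m y) z = dot y (M *m z).
Proof. by rewrite /dot trmx_mul trmxK mulmxA. Qed.

Lemma dot_col_mx (R : realType) n p (y1 z1 : 'cV[R]_n) (y2 z2 : 'cV[R]_p) :
  dot (col_mx y1 y2) (col_mx z1 z2) = dot y1 z1 + dot y2 z2.
Proof. by rewrite /dot tr_col_mx mul_row_col mxE. Qed.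

Lemma dot_scalar (R : realType) (a b : R) :
  dot (a%:M : 'cV[R]_1) b%:M = a * b.
Proof. by rewrite dotE big_ord1 !mxE eqxx. Qed.

Lemma ge0_of_perturbation (R : realType) (q N : R) :
  0 <= N -> (forall e, 0 < e -> 0 <= q + e * N) -> 0 <= q.
Proof.
move=> N0 qN; rewrite leNgt; apply/negP => q0.
have N1 : 0 < N + 1 by rewrite ltr_wpDl.
have := qN (- q / (N + 1)); rewrite divr_gt0 ?oppr_gt0// => /(_ isT).
have -> : q + - q / (N + 1) * N = q / (N + 1) by field; rewrite gt_eqF.
by rewrite leNgt -oppr_gt0 -mulNr divr_gt0 ?oppr_gt0.
Qed.

Section BluntCone.
Variables (R : realType) (V : lmodType R).

(** Convex cones with vertex at the origin that do not contain the vertex. *)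
Definition blunt_cone (K : set V) : Prop :=
  [/\ ~ K 0, (forall x y, K x -> K y -> K (x + y)) &
      (forall a x, 0 < a -> K x -> K (a *: x))].

(** Zorn's lemma gives a maximal blunt convex cone containing [K0]. If it
    contained neither [x] nor [- x], adjoining the open half-line through [x]
    would enlarge it without reaching the origin. Zorn is applied to the sets
    whose union with [K0] is a blunt cone, so that the empty chain is no
    exception. *)
Lemma blunt_cone_total_extension (K0 : set V) : blunt_cone K0 ->
  exists K : set V, [/\ blunt_cone K, K0 `<=` K &
    forall x, x != 0 -> K x \/ K (- x)].
Proof.
move=> K0cone.
have [F FP Ftot|A [Acone Amax]] :=
    @Zorn_bigcup V [set A | blunt_cone (A `|` K0)].
  rewrite /mkset; set G := (X in blunt_cone X).
  have GF B : F B -> B `|` K0 `<=` G.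
    by move=> FB y [By|]; [left; exists B|right].
  have common y z : G y -> G z ->
      exists C, [/\ blunt_cone C, C `<=` G, C y & C z].
    move=> [[A FA Ay]|K0y] [[B FB Bz]|K0z].
    - have [AB|BA] := Ftot _ _ FA FB.
        exists (B `|` K0); split; [exact: FP|exact: GF|left; exact: AB|by left].
      exists (A `|` K0); split; [exact: FP|exact: GF|by left|left; exact: BA].
    - exists (A `|` K0); split; [exact: FP|exact: GF|by left|by right].
    - exists (B `|` K0); split; [exact: FP|exact: GF|by right|by left].
    - by exists K0; split=> // v; right.
  split.
  - by move=> G0; have [C [[]]] := common 0 0 G0 G0.
  - move=> y z Gy Gz; have [C [[_ CD _] CG Cy Cz]] := common _ _ Gy Gz.
    by apply: CG; apply: CD.
  - move=> a y a0 Gy; have [C [[_ _ CZ] CG Cy _]] := common _ _ Gy Gy.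
    by apply: CG; apply: CZ.
exists (A `|` K0); split=> [//|y K0y|x x0]; first by right.
have [K0' KD KZ] := Acone; set K := A `|` K0 in K0' KD KZ *.
have [|Kx] := pselect (K x); first by left.
have [|KNx] := pselect (K (- x)); [by right|exfalso].
(* the cone generated by [K] and [x], without the origin *)
pose K' := [set y | exists k t, y = k + t *: x /\
  ((K k /\ 0 <= t) \/ (k = 0 /\ 0 < t))].
have KK' : K `<=` K'.
  by move=> k Kk; exists k, 0; rewrite scale0r addr0; split=> //; left.
have K'x : K' x.
  by exists 0, 1; rewrite scale1r add0r; split=> //; right.
apply: (Amax K').
  split; first by move=> y Ay; apply: KK'; left.
  by move=> K'A; apply: Kx; left; apply: K'A.
rewrite /mkset; have -> : K' `|` K0 = K'.
  by apply/seteqP; split=> [y [//|K0y]|y]; [apply: KK'; right|left].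
split.
- move=> [k [t [/esym/eqP]]]; rewrite addr_eq0 => /eqP -> [[Kk]|[/eqP k0 t0]].
  + rewrite le_eqVlt => /predU1P[t0|t0].
      by move: Kk; rewrite -t0 scale0r oppr0.
    apply: KNx; have := KZ t^-1 _ _ Kk.
    by rewrite scalerN scalerA mulVf ?gt_eqF// scale1r invr_gt0; apply.
  + by move: k0; rewrite oppr_eq0 scaler_eq0 gt_eqF//= (negbTE x0).
- move=> _ _ [k [t [-> kt]]] [l [s [-> ls]]]; exists (k + l), (t + s).
  split; first by rewrite scalerDl addrACA.
  case: kt => -[kK t0]; case: ls => -[lK s0].
  + by left; split; [apply: KD|apply: addr_ge0].
  + by left; rewrite lK addr0; split=> //; rewrite addr_ge0// ltW.
  + by left; rewrite kK add0r; split=> //; rewrite addr_ge0// ltW.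
  + by right; rewrite kK lK addr0 addr_gt0.
- move=> a _ a0 [k [t [-> kt]]]; exists (a *: k), (a * t).
  split; first by rewrite scalerDr scalerA.
  case: kt => -[kK t0].
    by left; rewrite mulr_ge0 ?(ltW a0)//; split=> //; apply: KZ.
  by right; rewrite kK scaler0 mulr_gt0.
Qed.

End BluntCone.

(** A total blunt cone [K] orders [R^n] linearly. Adding up the basis vectors,
    each with the sign that puts it in [K], gives an order unit [a], and
    [w i] is the cut that the [i]-th basis vector determines on the line of
    [a]: up to infinitesimals, [x] is [dot w x *: a]. *)
Lemma total_cone_functional (R : realType) n (K : set 'cV[R]_n) :
  (0 < n)%N -> blunt_cone K -> (forall x, x != 0 -> K x \/ K (- x)) ->
  exists2 w : 'cV[R]_n, w != 0 & forall x, K x -> 0 <= dot w x.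
Proof.
move=> n0 [K0 KD KZ] Ktot.
pose P x := K x \/ x = 0.
have PD x y : P x -> P y -> P (x + y).
  move=> [Kx|->] [Ky|->]; rewrite ?addr0 ?add0r; [|by left|by left|by right].
  by left; apply: KD.
have PZ c x : 0 <= c -> P x -> P (c *: x).
  rewrite le_eqVlt => /predU1P[<- _|c0 [Kx|->]].
  - by right; rewrite scale0r.
  - by left; apply: KZ.
  - by right; rewrite scaler0.
have Psum (I : finType) (f : I -> 'cV[R]_n) :
    (forall i, P (f i)) -> P (\sum_i f i).
  by move=> Pf; elim/big_rec: _ => [|i x _ Px]; [right|apply: PD].
have Ptot x : P x \/ P (- x).
  have [->|x0] := eqVneq x 0; first by left; right.
  by case: (Ktot x x0); [left; left|right; left].
have Panti x : P x -> P (- x) -> x = 0.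
  move=> [Kx|//] [KNx|/eqP]; last by rewrite oppr_eq0 => /eqP.
  by exfalso; apply: K0; rewrite -(subrr x); apply: KD.
pose e i : 'cV[R]_n := delta_mx i 0.
have /choice[s sP] i : exists s : R, (s = 1 \/ s = -1) /\ P (s *: e i).
  case: (Ptot (e i)) => Pe.
    by exists 1; rewrite scale1r; split=> //; left.
  by exists (-1); rewrite scaleN1r; split=> //; right.
have ss i : s i * s i = 1 by case: (sP i) => -[->|->] _; ring.
have s1 i : -1 <= s i <= 1 by case: (sP i) => -[->|->] _; lra.
pose a := \sum_i s i *: e i.
have ai i : a i 0 = s i.
  rewrite summxE (bigD1 i)//= big1 => [|j ji]; rewrite !mxE.
    by rewrite !eqxx mulr1 addr0.
  by rewrite eq_sym (negbTE ji) mulr0.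
have a0 : a != 0.
  apply/eqP => /matrixP/(_ (Ordinal n0) 0); rewrite ai mxE => s0.
  by have := ss (Ordinal n0); rewrite s0 mul0r => /esym/eqP; rewrite oner_eq0.
have Pa : P a by apply: Psum => i; case: (sP i).
have Pline r : P (r *: a) -> 0 <= r.
  move=> Pr; rewrite leNgt; apply/negP => r0; move/eqP: a0; apply.
  apply: Panti => //; have := PZ (- r^-1) _ _ Pr.
  rewrite scalerA mulNr mulVf ?lt_eqF// scaleN1r; apply.
  by rewrite oppr_ge0 invr_le0 ltW.
(* [a] dominates [e i] and [- e i], which bounds the cuts below *)
have Pbound i c : -1 <= c <= 1 -> P (a + c *: e i).
  move=> c1; rewrite /a (bigD1 i)//= addrAC -scalerDl; apply: PD.
    have -> : (s i + c) *: e i = (1 + c * s i) *: (s i *: e i).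
      rewrite scalerA mulrDl mul1r -mulrA ss mulr1//.
    apply: PZ; last by case: (sP i).
    by case: (sP i) => -[->|->] _; lra.
  rewrite big_mkcond /=; apply: Psum => j; case: ifP => _; last by right.
  by case: (sP j).
pose S i := [set r | P (e i - r *: a)].
have Ssup i : has_sup (S i).
  split.
    exists (-1); rewrite /S /= scaleN1r opprK addrC -[e i]scale1r.
    by apply: Pbound; lra.
  exists 1 => r Sr; rewrite -subr_ge0; apply: Pline.
  have -> : (1 - r) *: a = (a + (-1) *: e i) + (e i - r *: a).
    by rewrite scaleN1r addrA subrK scalerBl scale1r.
  by apply: PD => //; apply: Pbound; lra.
pose w := \col_i sup (S i).
have wle i eps : 0 < eps -> P (e i - (w i 0 - eps) *: a).
  move=> e0; rewrite mxE.
  have [r Sr wr] := sup_adherent e0 (Ssup i).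
  have -> : e i - (sup (S i) - eps) *: a =
      (e i - r *: a) + (r - (sup (S i) - eps)) *: a.
    by rewrite [in RHS]scalerBl addrA subrK.
  by apply: PD => //; apply: PZ => //; rewrite subr_ge0 ltW.
have wge i eps : 0 < eps -> P ((w i 0 + eps) *: a - e i).
  move=> e0; rewrite mxE.
  case: (Ptot (e i - (sup (S i) + eps) *: a)); last by rewrite opprB.
  move=> /(ub_le_sup (Ssup i).2); lra.
(* sum the cuts, taking the upper one where [x i 0 >= 0], the lower elsewhere *)
have wx x eps : 0 < eps ->
    P ((dot w x + eps * \sum_i `|x i 0|) *: a - x).
  move=> e0.
  have -> : (dot w x + eps * \sum_i `|x i 0|) *: a - x =
      \sum_i ((w i 0 * x i 0 + eps * `|x i 0|) *: a - x i 0 *: e i).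
    rewrite sumrB -scaler_suml big_split /= -dotE -mulr_sumr; congr (_ - _).
    rewrite [LHS]matrix_sum_delta; apply: eq_bigr => i _.
    by rewrite big_ord1.
  apply: Psum => i; case: (ger0P (x i 0)) => xi0.
    have -> : (w i 0 * x i 0 + eps * x i 0) *: a - x i 0 *: e i =
        x i 0 *: ((w i 0 + eps) *: a - e i).
      by rewrite scalerBr scalerA; congr (_ *: _ - _); ring.
    by apply: PZ => //; apply: wge.
  have -> : (w i 0 * x i 0 + eps * - x i 0) *: a - x i 0 *: e i =
      (- x i 0) *: (e i - (w i 0 - eps) *: a).
    rewrite scalerBr scalerA scaleNr addrC; congr (_ + _).
    by rewrite -scaleNr; congr (_ *: _); ring.
  by apply: PZ; [rewrite oppr_ge0 ltW|apply: wle].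
exists w => [|x Kx].
  (* a zero [w] would make the order unit [a] itself infinitesimal *)
  apply/eqP => w0; suff : 0 <= -1 :> R by rewrite ler0N1.
  apply: (@ge0_of_perturbation _ _ (\sum_i `|a i 0|)); first exact: sumr_ge0.
  move=> eps e0; apply: Pline; have := wx a _ e0.
  by rewrite w0 /dot trmx0 mul0mx mxE add0r [-1 + _]addrC scalerBl scale1r.
apply: (@ge0_of_perturbation _ _ (\sum_i `|x i 0|)); first exact: sumr_ge0.
move=> eps e0; apply: Pline; rewrite -[_ *: a](subrK x).
by apply: PD; [apply: wx|left].
Qed.

Lemma blunt_cone_separation (R : realType) n (K : set 'cV[R]_n) :
  (0 < n)%N -> blunt_cone K ->
  exists2 w : 'cV[R]_n, w != 0 & forall x, K x -> 0 <= dot w x.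
Proof.
move=> n0 /blunt_cone_total_extension[K' [K'cone KK' K'tot]].
have [w w0 wK] := total_cone_functional n0 K'cone K'tot.
by exists w => // x /KK'; apply: wK.
Qed.

(** * First-order conditions along segments *)

Section DirectionalDerivative.
Variables (R : realType) (V : normedModType R).

(** A one-sided bound suffices, as the derivative along [v i] is also the limit
    from the right. The summands have their own base points and directions,
    because the cost adds up the running costs at different times. *)
Lemma sum_derive_ge n (f : 'I_n -> V -> R) (z v : 'I_n -> V) (s M : R) :
  (forall i, differentiable (f i : V -> R^o) (z i)) -> 0 < s ->
  (forall h : R, 0 < h <= s ->
     h * M <= \sum_i (f i (z i + h *: v i) - f i (z i))) ->
  M <= \sum_i 'd (f i : V -> R^o) (z i) (v i).
Proof.
move=> df s0 fM.
pose q i (h : R) := h^-1 * (f i (z i + h *: v i) - f i (z i)).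
have q_cvg i : q i h @[h --> 0^'+] --> 'd (f i : V -> R^o) (z i) (v i).
  have right_dnbhs : (0 : R)^'+ --> 0^'.
    move=> P; rewrite /at_right /dnbhs !nbhs_simpl /within /=.
    by apply: filterS => h Ph h0; apply: Ph; rewrite gt_eqF.
  have <- : (fun h : R => h^-1 *: (((f i : V -> R^o) \o shift (z i)) (h *: v i)
      - (f i : V -> R^o) (z i))) = q i.
    by apply/funext => h; rewrite /q /= [h *: _ + _]addrC.
  apply: cvg_trans (cvg_app _ right_dnbhs) _.
  by rewrite -deriveE//; exact: diff_derivable.
have /cvgr_to_ge : \sum_i q i h @[h --> 0^'+] -->
    \sum_i 'd (f i : V -> R^o) (z i) (v i).
  by apply: cvg_big => //; exact: add_continuous.
apply; near=> h.
have h0 : 0 < h by near: h; exact: nbhs_right_gt.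
have hs : h <= s by near: h; exact: nbhs_right_le.
by rewrite -mulr_sumr mulrC ler_pdivlMr// mulrC fM// h0.
Unshelve. all: by end_near. Qed.

End DirectionalDerivative.

Section Convexity.
Variables (R : realType) (V : lmodType R) (U : set V).
Hypothesis U_convex : convex_set U.

Lemma convex_comb x y (k : R) : 0 <= k <= 1 -> U x -> U y ->
  U (k *: x + (1 - k) *: y).
Proof.
move=> /andP[k0 k1] Ux Uy.
by have := @U_convex x y (Itv01 k0 k1); rewrite !inE; apply.
Qed.

Lemma convex_segment x v (h s : R) : 0 < s -> 0 <= h <= s ->
  U x -> U (x + s *: v) -> U (x + h *: v).
Proof.
move=> s0 /andP[h0 hs] Ux Uxv.
have -> : x + h *: v = (h / s) *: (x + s *: v) + (1 - h / s) *: x.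
  rewrite scalerDr addrAC -scalerDl [h / s + _]addrC subrK scale1r scalerA.
  by rewrite divfK// gt_eqF.
by apply: convex_comb => //; rewrite ler_pdivrMr// mul1r hs divr_ge0// ltW.
Qed.

(** The step is the harmonic one that makes [x + step *: (v + w)] a convex
    combination of the two given points of [U]. *)
Lemma convex_directionD x v w (s r : R) : 0 < s -> 0 < r ->
  U (x + s *: v) -> U (x + r *: w) -> U (x + (s * r / (s + r)) *: (v + w)).
Proof.
move=> s0 r0 Uv Uw; have sr0 : s + r != 0 by rewrite gt_eqF// addr_gt0.
have -> : x + (s * r / (s + r)) *: (v + w) =
    (r / (s + r)) *: (x + s *: v) + (1 - r / (s + r)) *: (x + r *: w).
  rewrite !scalerDr addrACA -scalerDl [r / _ + _]addrC subrK scale1r !scalerA.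
  by congr (_ + (_ *: _ + _ *: _)); field.
apply: convex_comb => //; apply/andP; split.
  by rewrite divr_ge0 ?addr_ge0 ?ltW.
by rewrite ler_pdivrMr ?addr_gt0// mul1r lerDr ltW.
Qed.

End Convexity.

(** The graph of a convex function lies above its tangents: the difference
    quotients along the segment from [mu] to [nu] are at most the whole
    increment. *)
Lemma convex_gradient_ineq (R : realType) (d m : nat)
    (f : 'cV[R]_d * 'cV[R]_m -> R) (U : set 'cV[R]_m) xi mu nu :
  differentiable (f : _ -> R^o) (xi, mu) ->
  convex_function U (fun mu => f (xi, mu)) -> U mu -> U nu ->
  'd (f : _ -> R^o) (xi, mu) (0, nu - mu) <= f (xi, nu) - f (xi, mu).
Proof.
move=> df fU Umu Unu; rewrite -lerN2.
have := @sum_derive_ge R _ 1 (fun _ z => - f z) (fun=> (xi, mu))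
  (fun=> (0, nu - mu)) 1 (- (f (xi, nu) - f (xi, mu))).
rewrite !big_ord1 => /(_ (fun=> differentiableN df)); rewrite (diffN df) fctE.
apply=> // h /andP[h0 h1]; rewrite big_ord1.
have fh : f (xi, h *: nu + (1 - h) *: mu) <=
    h * f (xi, nu) + (1 - h) * f (xi, mu).
  by apply: (fU (Itv01 (ltW h0) h1)); rewrite inE.
have -> : (xi, mu) + h *: (0, nu - mu) = (xi, h *: nu + (1 - h) *: mu).
  congr pair; first by rewrite /= scaler0 addr0.
  by rewrite /= scalerBl scale1r scalerBr addrCA.
by lra.
Qed.

(** * Trajectories and variations *)

Lemma forward_recursion (X : Type) T (f : 'I_T -> X -> X) (x0 : X) :
  exists x : 'I_T.+1 -> X, x ord0 = x0 /\
    forall t, x (lift ord0 t) = f t (x (widen_ord (leqnSn T) t)).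
Proof.
pose z := fix z n := if n is n'.+1 then
  if insub n' is Some t then f t (z n') else z n' else x0.
exists (fun t => z t); split=> // t; rewrite -[LHS]/(z t.+1) /=.
by case: insubP => [s _ /val_inj ->|]; rewrite ?ltn_ord.
Qed.

Lemma backward_recursion (X : Type) T (f : 'I_T -> X -> X) (xT : X) :
  exists p : 'I_T.+1 -> X, p ord_max = xT /\
    forall t, p (widen_ord (leqnSn T) t) = f t (p (lift ord0 t)).
Proof.
have [x [x0 xS]] := forward_recursion (fun t => f (rev_ord t)) xT.
exists (fun t => x (rev_ord t)); split=> [|t].
  by rewrite -x0; congr x; apply: val_inj; rewrite /= subnn.
have -> : rev_ord (widen_ord (leqnSn T) t) = lift ord0 (rev_ord t).
  by apply: val_inj; rewrite /= /bump /= add1n -subSn.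
rewrite xS rev_ordK; congr (f t (x _)).
by apply: val_inj; rewrite /= /bump /= add1n subSS.
Qed.

Lemma telescope_ord (V : zmodType) T (g : 'I_T.+1 -> V) :
  \sum_(t < T) (g (lift ord0 t) - g (widen_ord (leqnSn T) t)) =
  g ord_max - g ord0.
Proof.
have E : \sum_(t < T) g (widen_ord (leqnSn T) t) + g ord_max =
    g ord0 + \sum_(t < T) g (lift ord0 t).
  by rewrite -big_ord_recl big_ord_recr.
rewrite sumrB; apply/eqP.
by rewrite subr_eq addrAC eq_sym subr_eq addrC E addrC.
Qed.

Section LinearDynamics.
Variables (R : realType) (T d m : nat).
Variables (A : 'I_T -> 'M[R]_d) (B : 'I_T -> 'M[R]_(d, m)).

Lemma state_dynamicsD x1 u1 x2 u2 :
  state_dynamics A B x1 u1 -> state_dynamics A B x2 u2 ->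
  state_dynamics A B (fun t => x1 t + x2 t) (fun t => u1 t + u2 t).
Proof. by move=> E1 E2 t; rewrite E1 E2 !mulmxDr addrACA. Qed.

Lemma state_dynamicsZ a x u : state_dynamics A B x u ->
  state_dynamics A B (fun t => a *: x t) (fun t => a *: u t).
Proof. by move=> E t; rewrite E -!scalemxAr scalerDr. Qed.

(** Summation by parts: the pairing of the costate with the state changes from
    one time to the next only through the inputs of the two equations. *)
Lemma costate_pairing (p y : 'I_T.+1 -> 'cV[R]_d) (g : 'I_T -> 'cV[R]_d)
    (del : 'I_T -> 'cV[R]_m) :
  (forall t, p (widen_ord (leqnSn T) t) =
    (A t)^T *m p (lift ord0 t) - g t) ->
  state_dynamics A B y del -> y ord0 = 0 ->
  dot (p ord_max) (y ord_max) =
  \sum_(t < T) (dot (g t) (y (widen_ord (leqnSn T) t)) +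
                dot (p (lift ord0 t)) (B t *m del t)).
Proof.
move=> pE yE y0; have := telescope_ord (fun t => dot (p t) (y t)).
rewrite y0 dotr0 subr0 => <-; apply: eq_bigr => t _.
by rewrite yE pE dotBl dotDr dot_tr; ring.
Qed.

End LinearDynamics.

Lemma freq_mapD (R : realType) T m (W : 'I_m -> {set 'I_T})
    (u v : 'I_T -> 'cV[R]_m) :
  freq_map W (fun t => u t + v t) = freq_map W u + freq_map W v.
Proof.
by rewrite /freq_map -big_split; apply: eq_bigr => t _; rewrite mulmxDr.
Qed.

Lemma freq_mapZ (R : realType) T m (W : 'I_m -> {set 'I_T}) a
    (u : 'I_T -> 'cV[R]_m) :
  freq_map W (fun t => a *: u t) = a *: freq_map W u.
Proof.
by rewrite /freq_map scaler_sumr; apply: eq_bigr => t _; rewrite scalemxAr.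
Qed.

(** * The cone of variations *)

Section Variations.
Variables (R : realType) (T d m : nat).
Variables (A : 'I_T -> 'M[R]_d) (B : 'I_T -> 'M[R]_(d, m)).
Variables (xini xfin : 'cV[R]_d).
Variables (c : 'I_T -> 'cV[R]_d * 'cV[R]_m -> R).
Variables (U : 'I_T -> set 'cV[R]_m) (W : 'I_m -> {set 'I_T}).
Hypothesis c_diff : forall t z, differentiable (c t : _ -> R^o) z.
Hypothesis U_convex : forall t, convex_set (U t).
Variables (x : 'I_T.+1 -> 'cV[R]_d) (u : 'I_T -> 'cV[R]_m).

Let x_ (t : 'I_T) := x (widen_ord (leqnSn T) t).

(** The differential of the cost at [(x, u)] in the direction [(y, del)]. *)
Definition dcost (y : 'I_T.+1 -> 'cV[R]_d) (del : 'I_T -> 'cV[R]_m) : R :=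
  \sum_t 'd (c t : _ -> R^o) (x_ t, u t) (y (widen_ord (leqnSn T) t), del t).

(** One step [s] serves all times, so that the varied controls are controls of a
    single competing trajectory. *)
Definition admissible (del : 'I_T -> 'cV[R]_m) : Prop :=
  exists2 s, 0 < s & forall t, U t (u t + s *: del t).

(** The slack [r] keeps the origin out of the cone: without it, the trivial
    variation would put it in. *)
Definition variation_cone : set 'cV[R]_(1 + (d + freq_dim R W)) :=
  [set z | exists y del (r : R), [/\ state_dynamics A B y del, y ord0 = 0,
     admissible del, 0 < r &
     z = col_mx (dcost y del + r)%:M (col_mx (y ord_max) (freq_map W del))]].

Lemma dcostD y1 del1 y2 del2 :
  dcost (fun t => y1 t + y2 t) (fun t => del1 t + del2 t) =
  dcost y1 del1 + dcost y2 del2.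
Proof.
rewrite /dcost -big_split; apply: eq_bigr => t _ /=.
by rewrite -linearD.
Qed.

Lemma dcostZ a y del :
  dcost (fun t => a *: y t) (fun t => a *: del t) = a * dcost y del.
Proof.
rewrite /dcost mulr_sumr; apply: eq_bigr => t _.
by rewrite -[RHS]/(a *: _) -linearZ.
Qed.

Lemma admissibleD del1 del2 : admissible del1 -> admissible del2 ->
  admissible (fun t => del1 t + del2 t).
Proof.
move=> [s s0 U1] [r r0 U2].
exists (s * r / (s + r)); first by rewrite divr_gt0 ?mulr_gt0 ?addr_gt0.
by move=> t; apply: convex_directionD.
Qed.

Lemma admissibleZ a del : 0 < a -> admissible del ->
  admissible (fun t => a *: del t).
Proof.
move=> a0 [s s0 Udel]; exists (s / a); first exact: divr_gt0.
by move=> t; rewrite scalerA divfK ?gt_eqF.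
Qed.

(** Moving from the optimal trajectory along a variation that respects the end
    point and the frequency constraint stays feasible, because the constraints
    are affine and the control sets convex. *)
Lemma optimal_dcost_ge0 y del : optimal A B c W xini xfin U x u ->
  state_dynamics A B y del -> y ord0 = 0 -> y ord_max = 0 ->
  freq_map W del = 0 -> admissible del -> 0 <= dcost y del.
Proof.
move=> [[xu [x0 xT] Uu Fu] xu_min] ydel y0 yT Fdel [s s0 Us].
apply: (sum_derive_ge (s := s)) => // h /andP[h0 hs].
rewrite mulr0 sumrB subr_ge0.
apply: (xu_min (fun t => x t + h *: y t) (fun t => u t + h *: del t)).
split.
- exact: (state_dynamicsD xu (state_dynamicsZ h ydel)).
- by rewrite y0 yT scaler0 !addr0.
- by move=> t; apply: (convex_segment (@U_convex t) s0) => //; rewrite (ltW h0).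
- by rewrite (freq_mapD W u) freq_mapZ Fu Fdel scaler0 addr0.
Qed.

Lemma variation_cone_blunt : optimal A B c W xini xfin U x u ->
  blunt_cone variation_cone.
Proof.
move=> xu_opt; split.
- move=> [y [del [r [ydel y0 Udel r0 /esym/eqP]]]].
  rewrite !col_mx_eq0 => /and3P[/eqP/matrixP/(_ 0 0) E /eqP yT /eqP F0].
  have := optimal_dcost_ge0 xu_opt ydel y0 yT F0 Udel.
  by move: E; rewrite !mxE eqxx mulr1n; lra.
- move=> z1 z2 [y1 [del1 [r1 [E1 y10 U1 r10 ->]]]].
  move=> [y2 [del2 [r2 [E2 y20 U2 r20 ->]]]].
  exists (fun t => y1 t + y2 t), (fun t => del1 t + del2 t), (r1 + r2).
  split; [exact: state_dynamicsD|by rewrite y10 y20 addr0|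
    exact: admissibleD|exact: addr_gt0|].
  by rewrite !add_col_mx dcostD freq_mapD addrACA -(raddfD (@scalar_mx R 1)).
- move=> a _ a0 [y [del [r [E y0 Udel r0 ->]]]].
  exists (fun t => a *: y t), (fun t => a *: del t), (a * r).
  split; [exact: state_dynamicsZ|by rewrite y0 scaler0|
    exact: admissibleZ|exact: mulr_gt0|].
  by rewrite !scale_col_mx dcostZ freq_mapZ -mulrDr scale_scalar_mx.
Qed.

(** The functional that separates [variation_cone] from the origin. The slack
    in the first coordinate of the cone makes its first coefficient
    nonnegative and, in the limit, disappears from the inequality. *)
Lemma multipliers_exist : optimal A B c W xini xfin U x u ->
  exists etaC w etau, [/\ 0 <= etaC, ~ [/\ etaC = 0, w = 0 & etau = 0] &
    forall y del, state_dynamics A B y del -> y ord0 = 0 -> admissible del ->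
      0 <= etaC * dcost y del + dot w (y ord_max) +
           dot (etau : 'cV[R]_(freq_dim R W)) (freq_map W del)].
Proof.
move=> xu_opt.
have [z z0 zK] := @blunt_cone_separation R (1 + (d + freq_dim R W)) _ isT
  (variation_cone_blunt xu_opt).
pose etaC := usubmx z 0 0; pose w := usubmx (dsubmx z).
pose etau := dsubmx (dsubmx z).
have zE : z = col_mx etaC%:M (col_mx w etau).
  by rewrite -mx11_scalar !vsubmxK.
have ineq y del r : state_dynamics A B y del -> y ord0 = 0 -> admissible del ->
    0 < r -> 0 <= etaC * dcost y del + dot w (y ord_max)
                  + dot etau (freq_map W del) + r * etaC.
  move=> ydel y0 Udel r0.
  have /zK : variation_cone
      (col_mx (dcost y del + r)%:M (col_mx (y ord_max) (freq_map W del))).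
    by exists y, del, r.
  by rewrite zE !dot_col_mx dot_scalar mulrDr [r * _]mulrC addrAC addrA addrAC.
have etaC0 : 0 <= etaC.
  have [[_ _ Uu _] _] := xu_opt.
  have := ineq (fun=> 0) (fun=> 0) 1; rewrite /dcost big1 => [|t _]; last first.
    exact: (linear0 ('d (c t : _ -> R^o) (x_ t, u t))).
  have -> : freq_map W (fun=> 0 : 'cV[R]_m) = 0.
    by rewrite /freq_map big1// => t _; rewrite mulmx0.
  rewrite !dotr0 mulr0 mul1r !add0r; apply=> //.
    by move=> t; rewrite !mulmx0 addr0.
  by exists 1 => // t; rewrite scaler0 addr0.
exists etaC, w, etau; split=> // [[C0 w0 u0]|y del ydel y0 Udel].
  by move/eqP: z0; apply; rewrite zE C0 w0 u0 raddf0 !col_mx0.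
by apply: (ge0_of_perturbation etaC0) => r r0; apply: ineq.
Qed.

(** The partial gradient in the state represents the total differential on
    directions with no control component. *)
Lemma dot_gradE (f : 'cV[R]_d * 'cV[R]_m -> R) xi mu y :
  differentiable (f : _ -> R^o) (xi, mu) ->
  dot (grad (fun xi => f (xi, mu)) xi) y = 'd (f : _ -> R^o) (xi, mu) (y, 0).
Proof.
move=> df.
have gradE i : grad (fun xi => f (xi, mu)) xi i 0 =
    'd (f : _ -> R^o) (xi, mu) (delta_mx i 0, 0).
  rewrite mxE -deriveE// /derive.
  apply: (congr1 (fun q : R -> R^o => lim (q @ 0^'))).
  apply/funext => h /=.
  by congr (_ *: (f (_, _) - _)); rewrite /= scaler0 add0r.
have -> : (y, 0 : 'cV[R]_m) = \sum_i y i 0 *: (delta_mx i 0, 0).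
  rewrite {1}[y]matrix_sum_delta; under eq_bigr do rewrite big_ord1.
  elim/big_rec2: _ => // i _ v _ <-; congr pair; rewrite /= ?scaler0 ?addr0//.
rewrite dotE linear_sum; apply: eq_bigr => i _.
by rewrite linearZ gradE mulrC.
Qed.

(** Eliminating the state from the separating inequality by means of the costate
    leaves a sum of terms, each depending on the control at a single time.
    Varying the control at time [t] alone isolates the term of that time. The
    adjoint vector that multiplies the dynamics at time [t] is
    [p (lift ord0 t)], the costate at time [t + 1]. *)
Lemma linearized_maximum_principle : optimal A B c W xini xfin U x u ->
  exists (p : 'I_T.+1 -> 'cV[R]_d) (etaC : R) (etau : 'cV[R]_(freq_dim R W)),
  [/\ 0 <= etaC, ~ [/\ p ord_max = 0, etaC = 0 & etau = 0],
    (forall t, p (widen_ord (leqnSn T) t) = (A t)^T *m p (lift ord0 t)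
       - etaC *: grad (fun xi => c t (xi, u t)) (x_ t)) &
    forall t mu, U t mu ->
      dot (p (lift ord0 t)) (B t *m (mu - u t))
        - dot etau (freq_block R W t *m (mu - u t))
      <= etaC * 'd (c t : _ -> R^o) (x_ t, u t) (0, mu - u t)].
Proof.
move=> xu_opt; have [[_ _ Uu _] _] := xu_opt.
have [etaC [w [etau [C0 nz ineq]]]] := multipliers_exist xu_opt.
pose g t := etaC *: grad (fun xi => c t (xi, u t)) (x_ t).
have [p [pT pS]] := backward_recursion (fun t q => (A t)^T *m q - g t) (- w).
exists p, etaC, etau; split=> // [[wN0 etaC0 etau0]|t mu Umu].
  by apply: nz; split=> //; rewrite -[w]opprK -pT wN0 oppr0.
pose del s := if s == t then mu - u t else 0.
have [y [y0 yS]] :=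
  forward_recursion (fun s z => A s *m z + B s *m del s) (0 : 'cV[R]_d).
have del_adm : admissible del.
  exists 1 => // s; rewrite scale1r /del.
  by case: eqP => [->|_]; rewrite ?addr0// addrC subrK.
have := ineq y del yS y0 del_adm; have := costate_pairing pS yS y0.
rewrite pT dotNl => /eqP; rewrite eqr_oppLR => /eqP ->.
rewrite /dcost /freq_map dot_sumr mulr_sumr -sumrN -!big_split /=.
rewrite (bigD1 t)//= big1 => [|s st]; last first.
  rewrite /del (negbTE st) dotZl dot_gradE//.
  by rewrite !mulmx0 !dotr0 !addr0 subrr.
rewrite addr0 /del eqxx dotZl dot_gradE//.
have -> : (y (widen_ord (leqnSn T) t), mu - u t) =
    (y (widen_ord (leqnSn T) t), 0) + (0, mu - u t).
  by congr pair; rewrite /= ?addr0 ?add0r.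
rewrite linearD mulrDr; lra.
Qed.

End Variations.

(** * The maximum principle *)

Theorem mainTheorem3 (R : realType) (T d m : nat)
    (T_gt0 : (0 < T)%N) (d_gt0 : (0 < d)%N) (m_gt0 : (0 < m)%N)
    (A : 'I_T -> 'M[R]_d) (B : 'I_T -> 'M[R]_(d, m))
    (xini xfin : 'cV[R]_d)
    (c : 'I_T -> 'cV[R]_d * 'cV[R]_m -> R)
    (U : 'I_T -> set 'cV[R]_m)
    (W : 'I_m -> {set 'I_T})
    (c_C1 : forall t, continuously_differentiable (c t))
    (c_convex : forall t xi, convex_function (U t) (fun mu => c t (xi, mu)))
    (U_convex : forall t, convex_set (U t))
    (U_compact : forall t, compact (U t))
    (U_nonempty : forall t, U t !=set0)
    (x : 'I_T.+1 -> 'cV[R]_d) (u : 'I_T -> 'cV[R]_m)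
    (xu_optimal : optimal A B c W xini xfin U x u) :
  exists (etaf : 'I_T -> 'cV[R]_d) (etaC : R) (etau : 'cV[R]_(freq_dim R W)),
    let H := hamiltonian A B c (W := W) etaC etau in
    let x_ := fun t : 'I_T => x (widen_ord (leqnSn T) t) in
    let first := ord_first T_gt0 in
    let last := ord_last T_gt0 in
    [/\ (* (i) *)
        0 <= etaC,
        (* (ii) *)
        ~ ((forall t, etaf t = 0) /\ (etaC = 0 /\ etau = 0)),
        (* (iii) *)
        state_dynamics A B x u /\
        (forall s t : 'I_T, t = s.+1 :> nat ->
          etaf s = (A t)^T *m etaf t
                   - etaC *: grad (fun xi => c t (xi, u t)) (x_ t)),
        (* (iv) *)
        [/\ dual_cone xini [set xini] = setT,
            dual_cone xfin [set xfin] = setT &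
            exists etax0 etaxT : 'cV[R]_d,
              [/\ dual_cone xini [set xini] etax0,
                  dual_cone xfin [set xfin] etaxT,
                  grad (fun xi => H (etaf first) first xi (u first)) (x_ first)
                    - etax0 = 0 &
                  etaf last = - etaxT]] &
        (* (v) and (vi) *)
        (forall t, is_maximum [set H (etaf t) t (x_ t) mu | mu in U t]
                              (H (etaf t) t (x_ t) (u t))) /\
        freq_map W u = 0].
Proof.
have c_diff t z : differentiable (c t : _ -> R^o) z by have [] := c_C1 t.
have [p [etaC [etau [etaC0 nontrivial adjoint maximum]]]] :=
  linearized_maximum_principle c_diff U_convex xu_optimal.
have [[xu [x0 xT] Uu Fu] _] := xu_optimal.
have dual_singleton v : dual_cone v [set v] = setT :> set 'cV[R]_d.
  by apply/seteqP; split=> // y _ z ->; rewrite subrr dotr0.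
have p_last : p (lift ord0 (ord_last T_gt0)) = p ord_max.
  by congr p; apply: val_inj; rewrite /= /bump /= add1n subn1 prednK.
exists (fun t => p (lift ord0 t)), etaC, etau => H x_ first last.
split=> //.
- by move=> [p0 [C0 u0]]; apply: nontrivial; split=> //; rewrite -p_last p0.
- split=> // s t ts; rewrite -adjoint; congr p.
  by apply: val_inj; rewrite /= ts.
- split=> //; exists (grad (fun xi => H (p (lift ord0 first)) first xi (u first))
    (x_ first)), (- p (lift ord0 last)).
  by rewrite !dual_singleton; split=> //; rewrite ?subrr ?opprK.
- split=> // t; split; first by exists (u t).
  move=> _ [mu Umu <-].
  have := maximum t mu Umu.
  have := ler_wpM2l etaC0
    (convex_gradient_ineq (c_diff t _) (c_convex t (x_ t)) (Uu t) Umu).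
  by rewrite /H /hamiltonian !mulmxBr !dotBr !dotDr mulrBr -/(x_ t); lra.
Qed.
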